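(* Let $\Sigma\cup\{\varphi\}$ be a countable set of $\mathcal{L}^{2}_{\Theta}$-sentences. If $\Sigma\nvdash\varphi$, then there is a standard structure $(\mathfrak{A},K^A_\Theta)$ such that $(\mathfrak{A},K^A_\Theta)\models\Sigma$ and $(\mathfrak{A},K^A_\Theta)\not\models\varphi$.
   Context: Fix a countable first-order vocabulary of predicate constants $P_0,P_1,\dots$ (with identity). Let $\Theta$ be a countable set of first-order formulas, each written $\theta(\overline{x},\overline{y})$ where $\overline{x}$ is a nonempty tuple of distinguished free variables (its length $l+1$ is the arity of $\theta$) and $\overline{y}$ lists the remaining free variables (parameters). Enumerate $\Theta$ as $\theta^{l+1}_n$ ($n,l\in\omega$), $l+1$ being the arity. The language $\mathcal{L}^{2}_{\Theta}$ is the second-order language over this vocabulary with first-order variables $x_0,x_1,\dots$ and, for each arity $l+1$, countably many second-order variables $V^{l+1}_m$; atomic formulas are the first-order ones together with $V^{l+1}_m(t_1,\dots,t_{l+1})$ and $V_m=V_n$ (same arity); formulas are built with $\neg,\wedge,\forall$ over both sorts (other connectives and $\exists$ defined as usual). Semantics: for a structure $\mathfrak{A}$ with domain $A$, $K^A_\Theta$ is the collection of all $B\subseteq A^k$ (all $k$) such that there is $\theta(\overline{x},\overline{y})\in\Theta$ with $\overline{x}$ of length $k$ and a sequence $\overline{e}$ of elements of $A$ with $B=\{\overline{d}:\mathfrak{A}\models\theta[\overline{d},\overline{e}]\}$. The pair $(\mathfrak{A},K^A_\Theta)$ is a standard structure; in it, second-order variables of arity $k$ range over the $k$-ary members of $K^A_\Theta$,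 and $V_m=V_n$ is interpreted as equality of relations. For a formula $\psi$, a second-order variable $V^{l+1}_m$ and $n\in\omega$, $\psi^{l+1,m}_n$ is obtained by replacing any expression $V^{l+1}_m(\overline{x})$ (not bound by a quantifier) in $\psi$ by $\theta^{l+1}_n(\overline{x},\overline{y})$ and prefixing the resulting formula with the string of quantifiers $\forall\overline{x}$. Proof system: any complete set of axioms for first-order logic, plus the schemata (A1) $\forall\overline{y}\,\exists V\,\forall\overline{x}\,(V(\overline{x})\leftrightarrow\theta(\overline{x},\overline{y}))$ for each $\theta(\overline{x},\overline{y})\in\Theta$; (A2) $\forall V_m,V_n(\forall\overline{x}(V_m(\overline{x})\leftrightarrow V_n(\overline{x}))\leftrightarrow V_m=V_n)$ (same arity); (A3) $\forall V_m,V_n(V_m=V_n\rightarrow(\psi\rightarrow\psi'))$ where $\psi'$ results from $\psi$ by replacing some occurrences of $V_m$ by $V_n$ (same arity); (A4) $\forall V_m\psi\rightarrow\psi(V_m/V_n)$ where $V_n$ is free for $V_m$ in $\psi$ (same arity); (A5) $\forall V_m(\psi\rightarrow\chi)\rightarrow(\psi\rightarrow\forall V_m\chi)$ where $V_m$ is not free in $\psi$; (A6) $\forall V^{l+1}_m\psi\rightarrow\psi^{l+1,m}_n$ for all $m,n$; and rules (R1) modus ponens; (R2) from $\psi$ infer $\forall V\psi$ and $\forall x\psi$; (R3) from $\chi\rightarrow\psi^{l+1,m}_0,\ \chi\rightarrow\psi^{l+1,m}_1,\dots$ infer $\chi\rightarrow\forall V^{l+1}_m\psi$. A deduction of $\psi$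 from $\Sigma$ is a countable sequence of formulas ending with $\psi$, each member of which is in $\Sigma$, an axiom, or obtained from previous members by one of (R1)–(R3); write $\Sigma\vdash\psi$. *)

(* Defs.v *)
From HB Require Import structures.
From mathcomp Require Import all_boot.
From mathcomp Require Import boolp classical_sets functions cardinality.
From mathcomp Require Import wochoice.

Set Implicit Arguments.
Unset Strict Implicit.
Unset Printing Implicit Defensive.

Local Open Scope classical_set_scope.

(* Predicate constants, at most countably many, with their numbers of *)
(* arguments. *)
Record vocabulary := Vocabulary {
  pconst : countType;
  parity : pconst -> nat }.

(* Variables of both sorts are de Bruijn indices. Second-order variables are *)
(* indexed separately for each arity l.+1, so the binder All2 l shifts only *)
(* the variables of arity l.+1, and leaves the first-order ones alone. *)

Definition scons T (x : T) (e : nat -> T) : nat -> T :=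
  fun i => if i is j.+1 then e j else x.

(* d_0, ..., d_{k-1}, e_0, e_1, ... *)
Definition cat_env T (d : seq T) (e : nat -> T) : nat -> T :=
  fun i => nth (e (i - size d)) d i.

Definition up (f : nat -> nat) : nat -> nat := scons 0 (S \o f).

Definition up2 (l : nat) (g : nat -> nat -> nat) : nat -> nat -> nat :=
  fun l' => if l' == l then up (g l') else g l'.

(* The renaming f on the second-order variables of arity l.+1 only. *)
Definition at_arity (l : nat) (f : nat -> nat) : nat -> nat -> nat :=
  fun l' => if l' == l then f else id.

Section Syntax.
Variable L : vocabulary.

Inductive fform :=
| FPred (p : pconst L) of (parity p).-tuple nat
| FEq of nat & nat
| FNeg of fform
| FAnd of fform & fform
| FAll of fform.

Inductive form :=
| Pred (p : pconst L) of (parity p).-tuple nat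
| Eq1 of nat & nat
| App (l : nat) of nat & l.+1.-tuple nat      (* V^{l+1}_m (t_1, .., t_{l+1}) *)
| Eq2 (l : nat) of nat & nat                   (* V^{l+1}_m = V^{l+1}_n *)
| Neg of form
| And of form & form
| All1 of form
| All2 (l : nat) of form.

Definition Imp a b := Neg (And a (Neg b)).
Definition Iff a b := And (Imp a b) (Imp b a).
Definition Ex2 l a := Neg (All2 l (Neg a)).

Fixpoint embed (t : fform) : form :=
  match t with
  | FPred p ts => Pred ts
  | FEq i j => Eq1 i j
  | FNeg a => Neg (embed a)
  | FAnd a b => And (embed a) (embed b)
  | FAll a => All1 (embed a)
  end.

Fixpoint fren (f : nat -> nat) (t : fform) : fform :=
  match t with
  | FPred p ts => FPred [tuple of map f ts]
  | FEq i j => FEq (f i) (f j)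
  | FNeg a => FNeg (fren f a)
  | FAnd a b => FAnd (fren f a) (fren f b)
  | FAll a => FAll (fren (up f) a)
  end.

Fixpoint ren (f : nat -> nat) (g : nat -> nat -> nat) (a : form) : form :=
  match a with
  | Pred p ts => Pred [tuple of map f ts]
  | Eq1 i j => Eq1 (f i) (f j)
  | App l m ts => App (g l m) [tuple of map f ts]
  | Eq2 l m n => Eq2 l (g l m) (g l n)
  | Neg b => Neg (ren f g b)
  | And b c => And (ren f g b) (ren f g c)
  | All1 b => All1 (ren (up f) g b)
  | All2 l b => All2 l (ren f (up2 l g) b)
  end.

Definition ren1 f := ren f (fun=> id).
Definition ren2 l f := ren id (at_arity l f).

(* All free variables of t are below fbound t. *)
Fixpoint fbound (t : fform) : nat :=
  match t with
  | FPred p ts => \max_(i <- ts) i.+1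
  | FEq i j => maxn i.+1 j.+1
  | FNeg a => fbound a
  | FAnd a b => maxn (fbound a) (fbound b)
  | FAll a => (fbound a).-1
  end.

Fixpoint free1 (k : nat) (a : form) : bool :=
  match a with
  | Pred p ts => k \in tval ts
  | Eq1 i j => (k == i) || (k == j)
  | App _ _ ts => k \in tval ts
  | Eq2 _ _ _ => false
  | Neg b => free1 k b
  | And b c => free1 k b || free1 k c
  | All1 b => free1 k.+1 b
  | All2 _ b => free1 k b
  end.

Fixpoint free2 (l k : nat) (a : form) : bool :=
  match a with
  | Pred _ _ | Eq1 _ _ => false
  | App l' m _ => (l' == l) && (m == k)
  | Eq2 l' m n => (l' == l) && ((m == k) || (n == k))
  | Neg b => free2 l k b
  | And b c => free2 l k b || free2 l k c
  | All1 b => free2 l k b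
  | All2 l' b => free2 l (if l' == l then k.+1 else k) b
  end.

Definition sentence (a : form) : Prop :=
  (forall k, ~~ free1 k a) /\ (forall l k, ~~ free2 l k a).

Definition All1s (p : nat) (a : form) : form := iter p All1 a.

(* The k innermost first-order variables 0, ..., k-1. *)
Definition vars (k : nat) : k.-tuple nat := [tuple of iota 0 k].

(* A member theta(x,y) of Theta of arity l.+1 is a first-order formula whose *)
(* distinguished variables x are 0, ..., l and whose parameters y are the *)
(* variables l.+1, l.+2, ... below fbound. A collection Theta is given by *)
(* its sets Theta l of members of arity l.+1. *)
Definition nparams (l : nat) (t : fform) : nat := fbound t - l.+1.

(* theta(ts,y), where variable number y j stands for the j-th parameter. *)
Definition fapp k (t : fform) (ts : k.-tuple nat) (y : nat -> nat) : form :=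
  embed (fren (cat_env ts y) t).

(* The replacement of V^{l+1}_m by theta( . ,y), after which the index m is *)
(* removed. An identity V_m = V_n has to be replaced too, as otherwise V_m *)
(* would remain free; it is first expanded into forall x (V_m(x) <-> V_n(x)). *)
Definition psub_app (l : nat) (t : fform) (m : nat) (y : nat -> nat)
    (l' k : nat) (ts : l'.+1.-tuple nat) : form :=
  if l' == l then
    if k == m then fapp t ts y else App (unbump m k) ts
  else App k ts.

Fixpoint psub (l : nat) (t : fform) (m : nat) (y : nat -> nat) (a : form) :=
  match a with
  | Pred p ts => Pred ts
  | Eq1 i j => Eq1 i j
  | App l' k ts => psub_app l t m y k ts
  | Eq2 l' j k =>
      if l' == l then
        if (j == m) || (k == m) then
          let y' := addn l'.+1 \o y in
          All1s l'.+1 (Iff (psub_app l t m y' j (vars l'.+1))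
                           (psub_app l t m y' k (vars l'.+1)))
        else Eq2 l' (unbump m j) (unbump m k)
      else Eq2 l' j k
  | Neg b => Neg (psub l t m y b)
  | And b c => And (psub l t m y b) (psub l t m y c)
  | All1 b => All1 (psub l t m (S \o y) b)
  | All2 l' b => All2 l' (psub l t (if l' == l then m.+1 else m) y b)
  end.

(* forall y, a(theta( . ,y)), a being the scope of a quantifier All2 l; the *)
(* prefix binds the parameters y of theta. *)
Definition instance (l : nat) (t : fform) (a : form) : form :=
  let p := nparams l t in
  All1s p (psub l t 0 id (ren1 (addn p) a)).

Definition tautology (a : form) : Prop :=
  forall v : form -> bool,
    (forall b, v (Neg b) = ~~ v b) ->
    (forall b c, v (And b c) = v b && v c) -> v a.

(* The constructors ax_taut, ..., ax_eq are a complete set of axioms for *)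
(* first-order logic with identity (with the rules of modus ponens and *)
(* generalization). In ax_eq and A3, index 0 of the scheme b marks the *)
(* replaced occurrences; ren1 S and ren2 l S express that the quantified *)
(* variable is not free. *)
Inductive is_axiom (Theta : nat -> set fform) : form -> Prop :=
| ax_taut a : tautology a -> is_axiom Theta a
| ax_inst a k : is_axiom Theta (Imp (All1 a) (ren1 (scons k id) a))
| ax_distr a b :
    is_axiom Theta (Imp (All1 (Imp (ren1 S a) b)) (Imp a (All1 b)))
| ax_refl i : is_axiom Theta (Eq1 i i)
| ax_eq b i j :
    is_axiom Theta (Imp (Eq1 i j)
                   (Imp (ren1 (scons i id) b) (ren1 (scons j id) b)))
| A1 l t : Theta l t ->
    is_axiom Theta
      (All1s (nparams l t)
        (Ex2 l (All1s l.+1 (Iff (@App l 0 (vars l.+1)) (embed t)))))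
| A2 l :
    is_axiom Theta
      (All2 l (All2 l
        (Iff (All1s l.+1 (Iff (@App l 1 (vars l.+1)) (@App l 0 (vars l.+1))))
             (Eq2 l 1 0))))
| A3 l b :
    is_axiom Theta
      (All2 l (All2 l
        (Imp (Eq2 l 1 0)
             (Imp (ren2 l (scons 1 id) b) (ren2 l (scons 0 id) b)))))
| A4 l a n : is_axiom Theta (Imp (All2 l a) (ren2 l (scons n id) a))
| A5 l a b :
    is_axiom Theta (Imp (All2 l (Imp (ren2 l S a) b)) (Imp a (All2 l b)))
| A6 l t a : Theta l t -> is_axiom Theta (Imp (All2 l a) (instance l t a)).

(* prev is the set of the previous members of the deduction. *)
Inductive justified (Theta : nat -> set fform) (Sigma prev : set form) :
  form -> Prop :=
| by_hyp a : Sigma a -> justified Theta Sigma prev a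
| by_axiom a : is_axiom Theta a -> justified Theta Sigma prev a
| R1 a b : prev (Imp a b) -> prev a -> justified Theta Sigma prev b
| R2_first a : prev a -> justified Theta Sigma prev (All1 a)
| R2_second l a : prev a -> justified Theta Sigma prev (All2 l a)
| R3 l c a : (forall t, Theta l t -> prev (Imp c (instance l t a))) ->
    justified Theta Sigma prev (Imp c (All2 l a)).

(* The members of a deduction are indexed by a countable well-order (possibly *)
(* transfinite) that has a last element. *)
Definition deduction (Theta : nat -> set fform) (Sigma : set form) (a : form)
    (I : countType) (le : rel I) (s : I -> form) : Prop :=
  [/\ well_order le,
      exists2 z : I, (forall i, le i z) & s z = a
    & forall i, justified Theta Sigma
                  (s @` [set j | le j i && (j != i)]) (s i)].

Definition provable (Theta : nat -> set fform) (Sigma : set form) (a : form) :=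
  exists (I : countType) (le : rel I) (s : I -> form),
    deduction Theta Sigma a le s.

Record structure := Structure {
  dom : Type;
  dom_inhabited : inhabited dom;
  interp : forall p : pconst L, set ((parity p).-tuple dom) }.

Section Semantics.
Variable A : structure.

Fixpoint fsat (e : nat -> dom A) (t : fform) : Prop :=
  match t with
  | FPred p ts => interp [tuple of map e ts]
  | FEq i j => e i = e j
  | FNeg a => ~ fsat e a
  | FAnd a b => fsat e a /\ fsat e b
  | FAll a => forall x, fsat (scons x e) a
  end.

Definition valuation2 := forall l : nat, nat -> set (l.+1.-tuple (dom A)).

Definition update2 (l : nat) (B : set (l.+1.-tuple (dom A)))
    (V : valuation2) : valuation2 :=
  @dfwith _ (fun l' => nat -> set (l'.+1.-tuple (dom A))) V l (scons B (V l)).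

(* The members of K^A_Theta of arity l.+1. *)
Definition definable (Theta : nat -> set fform) (l : nat) :
    set (set (l.+1.-tuple (dom A))) :=
  [set B | exists2 t, Theta l t &
     exists e : nat -> dom A,
       B = [set d : l.+1.-tuple (dom A) | fsat (cat_env d e) t]].

Fixpoint sat (Theta : nat -> set fform) (e : nat -> dom A) (V : valuation2)
    (a : form) : Prop :=
  match a with
  | Pred p ts => interp [tuple of map e ts]
  | Eq1 i j => e i = e j
  | App l m ts => V l m [tuple of map e ts]
  | Eq2 l m n => V l m = V l n
  | Neg b => ~ sat Theta e V b
  | And b c => sat Theta e V b /\ sat Theta e V c
  | All1 b => forall x, sat Theta (scons x e) V b
  | All2 l b => forall B : set (l.+1.-tuple (dom A)),
      definable Theta B -> sat Theta e (update2 B V) b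
  end.

Definition models (Theta : nat -> set fform) (a : form) : Prop :=
  forall e V, (forall l m, definable Theta (V l m)) -> sat Theta e V a.

End Semantics.
End Syntax.

(* Main.v *)
(* Rasiowa-Sikorski argument. If phi is not provable, build a decreasing      *)
(* sequence of consistent formulas below Neg phi that meets countably many    *)
(* dense sets: every formula is decided, every refuted universal formula has  *)
(* a refuted instance at a variable, and every second-order variable is       *)
(* declared equal to some theta(.,y). The last sets are dense by rule R3 and  *)
(* axiom A6: a formula incompatible with V = theta(.,y) for all theta and y   *)
(* is refutable. The variables modulo the identities of the resulting         *)
(* ultrafilter form a first-order structure. The relations named by the       *)
(* second-order variables are exactly its members of K_Theta: they are        *)
(* definable by the last dense sets, and conversely each definable relation   *)
(* is named, by A1. Hence truth in this structure is membership in the        *)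
(* ultrafilter.                                                               *)

Require Import Defs.
From mathcomp Require Import all_boot.
From mathcomp Require Import boolp classical_sets functions cardinality.
From mathcomp Require Import wochoice.

Set Implicit Arguments.
Unset Strict Implicit.
Unset Printing Implicit Defensive.

Local Open Scope classical_set_scope.

(** * Renamings *)

(** Call [c] consistent when [Neg c] is not provable from [Sigma]. The consistent formulas,
    preordered by provable implication, are countably many, and a filter meeting suitable countably
    many dense sets is a Henkin set containing every consequence of [Sigma] ([generic_filter],
    [henkin_exists]).

    Three facts carry the proof. Deductions are transfinite because of R3, but countably many of
    them can be concatenated, so provability is closed under all rules ([provable_justified]);
    nothing else about deductions is used. Naming a second-order variable is dense
    ([pr_Neg_unnamed]): if [c] refutes V = theta(.,y) for all theta and y, substituting theta for V
    makes the refuted formula provable and so refutes [c]; R3 collects these cases into forall V ~c.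
    In the term model the named relations are exactly the members of K_Theta ([named_rel_definable],
    [definable_named_rel]), so second-order quantifiers range over what the variables denote, and
    truth is membership ([sat_term_model]).

    Variables themselves serve as Henkin witnesses, since every formula leaves infinitely many of
    them fresh ([pr_All1_fresh], [pr_All2_fresh]). *)

Lemma up_comp f g : up (f \o g) = up f \o up g.
Proof. by apply/funext => -[|i]. Qed.

Lemma up_id : up id = id.
Proof. by apply/funext => -[|i]. Qed.

Lemma up2_comp l f g :
  up2 l (fun l' => f l' \o g l') = fun l' => up2 l f l' \o up2 l g l'.
Proof.
by apply/funext => l'; rewrite /up2; case: eqP => // _; rewrite up_comp.
Qed.

Lemma up2_id l : up2 l (fun=> id) = fun=> id.
Proof. by apply/funext => l'; rewrite /up2 up_id; case: eqP. Qed.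

Lemma up2_at_arity l f : up2 l (at_arity l f) = at_arity l (up f).
Proof. by apply/funext => l'; rewrite /up2 /at_arity; case: eqP. Qed.

Lemma at_arity_comp l f g :
  (fun l' => at_arity l f l' \o at_arity l g l') = at_arity l (f \o g).
Proof. by apply/funext => l'; rewrite /at_arity; case: eqP. Qed.

Lemma iter_up k f i :
  iter k up f i = if i < k then i else k + f (i - k).
Proof.
elim: k i => [|k IH] i; first by rewrite subn0.
by case: i => [|i] //=; rewrite IH ltnS subSS; case: ifP.
Qed.

Lemma iter_up_id k : iter k up id = id.
Proof. by elim: k => //= k ->; rewrite up_id. Qed.

Lemma iter_up_comp k f g : iter k up (f \o g) = iter k up f \o iter k up g.
Proof. by elim: k => //= k ->; rewrite up_comp. Qed.

(** Links substitution to naming: theta applied to the bound variables themselves is theta renamed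
    under [k] binders. *)
Lemma cat_env_vars k y : cat_env (vars k) (addn k \o y) = iter k up y.
Proof.
apply/funext => i; rewrite iter_up /cat_env size_tuple.
case: ltnP => h; first by rewrite nth_iota.
by rewrite nth_default // size_tuple.
Qed.

Lemma cat_env_map A B (f : A -> B) (d : seq A) e :
  cat_env (map f d) (f \o e) = f \o cat_env d e.
Proof.
apply/funext => i /=; rewrite /cat_env size_map.
case: (ltnP i (size d)) => h; first exact: nth_map.
by rewrite !nth_default // size_map.
Qed.

Lemma map_tuple_ext (T T' : eqType) n (ts : n.-tuple T) (f g : T -> T') :
  (forall x, x \in tval ts -> f x = g x) ->
  [tuple of map f ts] = [tuple of map g ts].
Proof. by move=> h; apply/val_inj => /=; apply/eq_in_map. Qed.

Lemma map_tuple_comp T T' T'' n (ts : n.-tuple T) (f : T' -> T'') (g : T -> T') :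
  [tuple of map f [tuple of map g ts]] = [tuple of map (f \o g) ts].
Proof. by apply/val_inj => /=; rewrite -map_comp. Qed.

Lemma map_tuple_id T n (ts : n.-tuple T) : [tuple of map id ts] = ts.
Proof. by apply/val_inj => /=; rewrite map_id. Qed.

Section Renaming.
Variable L : vocabulary.
Implicit Types (a b c : form L) (t : fform L).

Lemma ren_id a : ren id (fun=> id) a = a.
Proof.
elim: a => //= [p ts|l m ts|b ->|b -> c ->|b|l b] //.
- by rewrite map_tuple_id.
- by rewrite map_tuple_id.
- by rewrite up_id => ->.
- by rewrite up2_id => ->.
Qed.

Lemma ren_ren f g f' g' a :
  ren f g (ren f' g' a) = ren (f \o f') (fun l => g l \o g' l) a.
Proof.
elim: a f g f' g' => //= [p ts|l m ts|b IH|b IH c IH'|b IH|l b IH] f g f' g'.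
- by rewrite map_tuple_comp.
- by rewrite map_tuple_comp.
- by rewrite IH.
- by rewrite IH IH'.
- by rewrite IH up_comp.
- by rewrite IH up2_comp.
Qed.

Lemma ren_ext a f f' g g' :
  (forall k, free1 k a -> f k = f' k) ->
  (forall l k, free2 l k a -> g l k = g' l k) -> ren f g a = ren f' g' a.
Proof.
elim: a f f' g g' => //= [p ts|i j|l m ts|l m n|b IH|b IH c IH'|b IH|l b IH]
  f f' g g' hf hg.
- by rewrite (map_tuple_ext hf).
- by rewrite !hf ?eqxx ?orbT.
- by rewrite (map_tuple_ext hf) hg ?eqxx.
- by rewrite !hg ?eqxx ?orbT.
- by rewrite (IH f f' g g').
- rewrite (IH f f' g g') 1?(IH' f f' g g') //.
  + by move=> k h; apply: hf; rewrite h orbT.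
  + by move=> l k h; apply: hg; rewrite h orbT.
  + by move=> k h; apply: hf; rewrite h.
  + by move=> l k h; apply: hg; rewrite h.
- congr All1; apply: IH => // -[|k] //= h; congr S; exact: hf.
- congr All2; apply: IH => // l' k h; rewrite /up2.
  have := hg l'; rewrite eq_sym; case: (l' == l) => hl; last exact: hl.
  by case: k h => //= k h; congr S; apply: hl.
Qed.

Lemma sentence_ren a f g : sentence a -> ren f g a = a.
Proof.
move=> [h1 h2]; rewrite -[RHS]ren_id; apply: ren_ext => [k|l k].
  by rewrite (negbTE (h1 k)).
by rewrite (negbTE (h2 l k)).
Qed.

(** Provides fresh variables, and reduces a renaming to its values at finitely many indices. *)
Lemma free1_bounded a : exists N, forall k, free1 k a -> k < N.
Proof.
have tup n (ts : n.-tuple nat) :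
    exists N, forall k, k \in tval ts -> k < N.
  by exists (\max_(i <- ts) i).+1 => k h; rewrite ltnS; apply: leq_bigmax_seq.
elim: a => //= [i j|_ _|b [N hN] c [M hM]|b [N hN]].
- by exists (i + j).+1 => k /orP[] /eqP ->; rewrite ltnS (leq_addr, leq_addl).
- by exists 0.
- exists (N + M) => k /orP[/hN|/hM] h; apply: leq_trans h _.
    exact: leq_addr.
  exact: leq_addl.
- by exists N => k /hN; apply: ltnW.
Qed.

Lemma free2_bounded l a : exists N, forall k, free2 l k a -> k < N.
Proof.
elim: a => //= [p _|_ _|l' m _|l' m n|b [N hN] c [M hM]|l' b [N hN]].
- by exists 0.
- by exists 0.
- by exists m.+1 => k /andP[_ /eqP ->].
- by exists (m + n).+1 => k /andP[_ /orP[]] /eqP <-;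
    rewrite ltnS (leq_addr, leq_addl).
- exists (N + M) => k /orP[/hN|/hM] h; apply: leq_trans h _.
    exact: leq_addr.
  exact: leq_addl.
- by exists N => k /hN; case: ifP => // _; apply: ltnW.
Qed.

Lemma ren1_ren1 f g a : ren1 f (ren1 g a) = ren1 (f \o g) a.
Proof. exact: ren_ren. Qed.

Lemma ren2_ren2 l f g a : ren2 l f (ren2 l g a) = ren2 l (f \o g) a.
Proof. by rewrite /ren2 ren_ren at_arity_comp. Qed.

Lemma ren1_id a : ren1 id a = a.
Proof. exact: ren_id. Qed.

Lemma ren2_id l a : ren2 l id a = a.
Proof.
rewrite -[RHS]ren_id; congr ren; apply/funext => l'; rewrite /at_arity.
by case: eqP.
Qed.

Lemma ren1_ext a f f' :
  (forall k, free1 k a -> f k = f' k) -> ren1 f a = ren1 f' a.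
Proof. by move=> h; apply: ren_ext. Qed.

Lemma ren2_ext l a f f' :
  (forall k, free2 l k a -> f k = f' k) -> ren2 l f a = ren2 l f' a.
Proof.
move=> h; apply: ren_ext => // l' k; rewrite /at_arity.
by case: eqP => // -> /h.
Qed.

Lemma ren_All1s f g p a :
  ren f g (All1s p a) = All1s p (ren (iter p up f) g a).
Proof. by elim: p f => //= p IH f; rewrite IH -iterSr. Qed.

Lemma ren1_All1s f p a : ren1 f (All1s p a) = All1s p (ren1 (iter p up f) a).
Proof. exact: ren_All1s. Qed.

Lemma ren2_All1s l f p a : ren2 l f (All1s p a) = All1s p (ren2 l f a).
Proof. by rewrite /ren2 ren_All1s iter_up_id. Qed.

Lemma ren2_iter_All2 l f k a :
  ren2 l f (iter k (All2 l) a) = iter k (All2 l) (ren2 l (iter k up f) a).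
Proof.
elim: k f => //= k IH f.
by rewrite {1}/ren2 /= up2_at_arity -/(ren2 _ _ _) IH -iterSr.
Qed.

Lemma fren_id t : fren id t = t.
Proof.
elim: t => //= [p ts|b ->|b -> c ->|b] //; first by rewrite map_tuple_id.
by rewrite up_id => ->.
Qed.

Lemma fren_fren f g t : fren f (fren g t) = fren (f \o g) t.
Proof.
elim: t f g => //= [p ts|b IH|b IH c IH'|b IH] f g.
- by rewrite map_tuple_comp.
- by rewrite IH.
- by rewrite IH IH'.
- by rewrite IH up_comp.
Qed.

Lemma fren_ext t f f' :
  (forall k, k < fbound t -> f k = f' k) -> fren f t = fren f' t.
Proof.
elim: t f f' => //= [p ts|i j|b IH|b IH c IH'|b IH] f f' hf.
- by rewrite (@map_tuple_ext _ _ _ _ f f') // => x h; apply: hf;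
    exact: leq_bigmax_seq.
- by rewrite !hf // leq_max leqnn ?orbT.
- by rewrite (IH f f').
- rewrite (IH f f') 1?(IH' f f') // => k h; apply: hf; rewrite leq_max h //.
  by rewrite orbT.
- congr FAll; apply: IH => -[|k] //= h; congr S; apply: hf.
  by case: (fbound b) h.
Qed.

Lemma ren_embed f g t : ren f g (embed t) = embed (fren f t).
Proof. by elim: t f => //= [b IH|b IH c IH'|b IH] f; rewrite IH ?IH'. Qed.

End Renaming.

(** * Countability and deductions *)

Section Countability.
Variable L : vocabulary.

Fixpoint form_tree (a : form L) : GenTree.tree nat :=
  match a with
  | Pred p ts => GenTree.Node 0
      (GenTree.Leaf (pickle p) :: map (@GenTree.Leaf _) ts)
  | Eq1 i j => GenTree.Node 1 [:: GenTree.Leaf i; GenTree.Leaf j]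
  | App l m ts => GenTree.Node 2
      [:: GenTree.Leaf l, GenTree.Leaf m & map (@GenTree.Leaf _) ts]
  | Eq2 l m n => GenTree.Node 3
      [:: GenTree.Leaf l; GenTree.Leaf m; GenTree.Leaf n]
  | Neg b => GenTree.Node 4 [:: form_tree b]
  | And b c => GenTree.Node 5 [:: form_tree b; form_tree c]
  | All1 b => GenTree.Node 6 [:: form_tree b]
  | All2 l b => GenTree.Node 7 [:: GenTree.Leaf l; form_tree b]
  end.

Lemma form_tree_inj : injective form_tree.
Proof.
have Leaf_inj : injective (@GenTree.Leaf nat) by move=> x y [].
elim=> [p ts|i j|l m ts|l m n|b IH|b IH c IH'|b IH|l b IH] [] //=.
(* The length of the tuple depends on the predicate constant, so the constants are identified before
   the tuples. *)
- move=> q us [/(pcan_inj pickleK) epq]; case: q / epq us => us.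
  by move/(inj_map Leaf_inj)/val_inj ->.
- by move=> i' j' [-> ->].
- move=> l' m' us [ell <-]; case: l' / ell us => us.
  by move/(inj_map Leaf_inj)/val_inj ->.
- by move=> l' m' n' [-> -> ->].
- by move=> b' [/IH ->].
- by move=> b' c' [/IH -> /IH' ->].
- by move=> b' [/IH ->].
- by move=> l' b' [-> /IH ->].
Qed.

Lemma form_enumeration : exists s : nat -> form L, forall a, exists n, s n = a.
Proof.
pose code a := pickle (form_tree a).
have code_inj : injective code.
  exact: inj_comp (pcan_inj pickleK) form_tree_inj.
have [s hs] : {s : nat -> form L & forall n a, code a = n -> s n = a}.
  apply: (@choice _ _ (fun n b => forall a, code a = n -> b = a)) => n.
  have [[a <-]|h] := pselect (exists a, code a = n).
    by exists a => b /code_inj.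
  (* An arbitrary default for numbers that code no formula. *)
  by exists (Eq1 L 0 0) => a ha; case: h; exists a.
by exists s => a; exists (code a); apply: hs.
Qed.

End Countability.

(** Least elements are unique in a [well_order], and both [x] and [y] are least in the pair they
    form. *)
Lemma well_order_antisym (T : eqType) (le : rel T) x y :
  well_order le -> le x y -> le y x -> x = y.
Proof.
move=> wo lexy leyx.
have [|z [_ zP]] := wo (pred2 x y); first by exists x; rewrite inE eqxx.
have lerefl u : le u u.
  have [|w [[+ wP] _]] := wo (pred1 u); first by exists u; rewrite inE.
  by rewrite inE => /eqP ewu; subst w; apply: wP; rewrite inE.
have <- : z = x.
  by apply: zP; split=> [|u]; rewrite !inE ?eqxx // => /orP[] /eqP ->.
apply: zP; split=> [|u]; rewrite !inE ?eqxx ?orbT // => /orP[] /eqP -> //.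
Qed.

(* The ordinal sum of the orders le n (n < omega), followed by a last point. *)
Section OrderedSum.
Variables (I : nat -> countType) (le : forall n, rel (I n)).
Hypothesis le_wo : forall n, well_order (@le n).

Definition sum_le : rel (option {n : nat & I n}) := fun x y =>
  match x, y with
  | _, None => true
  | None, Some _ => false
  | Some u, Some v => (tag u < tag v) ||
      (tag u == tag v) && le (tagged u) (tagged_as u v)
  end.

Lemma sum_le_same n (i j : I n) :
  sum_le (Some (Tagged I i)) (Some (Tagged I j)) = le i j.
Proof. by rewrite /= ltnn eqxx tagged_asE. Qed.

(** The least element is the least one in the first block that meets [A]; if no block does, [A]
    contains only the last point. *)
Lemma sum_le_wo : well_order sum_le.
Proof.
apply: antisymmetric_well_order => [[[n i]|] [[m j]|] //|A [x Ax]].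
  case/andP; case: (ltngtP n m) => [h|h|e].
  - by rewrite /= h (gtn_eqF h) ltnNge (ltnW h).
  - by rewrite /= ltnNge (ltnW h) (gtn_eqF h).
  case: m / e j => j; rewrite !sum_le_same => h1 h2.
  by rewrite (well_order_antisym (@le_wo n) h1 h2).
pose B n := `[< exists i : I n, Some (Tagged I i) \in A >].
have [[n0 Bn0]|noB] := pselect (exists n, B n); last first.
  exists x; split=> // -[[n i]|] Ay; last by case: (x).
  by case: noB; exists n; apply/asboolP; exists i.
have [n /asboolP[i0 Ai0] n_min] := ex_minnP (ex_intro _ n0 Bn0).
have [|i [[Ai i_min] _]] := @le_wo n [pred i | Some (Tagged I i) \in A].
  by exists i0; rewrite inE.
exists (Some (Tagged I i)); split => // -[[m j]|] // Aj.
have : n <= m by apply: n_min; apply/asboolP; exists j.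
rewrite leq_eqVlt => /orP[/eqP e|/= -> //].
by case: m / e j Aj => j Aj; rewrite sum_le_same; apply: i_min.
Qed.

End OrderedSum.

Section Closure.
Variables (L : vocabulary) (Theta : nat -> set (fform L)) (Sigma : set (form L)).

Lemma justified_mono (P Q : set (form L)) a :
  P `<=` Q -> justified Theta Sigma P a -> justified Theta Sigma Q a.
Proof.
move=> PQ; case=> [b|b|b c h1 h2|b h|l b h|l c b h].
- exact: by_hyp.
- exact: by_axiom.
- by apply: (R1 _ _ (a := b)); apply: PQ.
- by apply: R2_first; apply: PQ.
- by apply: R2_second; apply: PQ.
- by apply: R3 => t /h; apply: PQ.
Qed.

(* As there are countably many formulas, deductions of all the provable ones *)
(* can be concatenated into a single one, to which the new step is added. *)
Lemma provable_justified a :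
  justified Theta Sigma (provable Theta Sigma) a -> provable Theta Sigma a.
Proof.
move=> ja.
have [enum enumP] := form_enumeration L.
pose D := {I : countType & (rel I * (I -> form L))%type}.
pose good (n : nat) (d : D) :=
  let: existT K (le, s) := d in
  [/\ well_order le,
      forall i, justified Theta Sigma (s @` [set j | le j i && (j != i)]) (s i)
    & provable Theta Sigma (enum n) -> exists i, s i = enum n].
have [d dP] : {d : nat -> D & forall n, good n (d n)}.
  apply: choice => n.
  have [[I [le [s [wo [z _ sz] j]]]]|np] := pselect (provable Theta Sigma (enum n)).
    by exists (existT _ I (le, s)); split => // _; exists z.
  (* An unprovable formula contributes an empty block. *)
  exists (existT _ (void : countType) (fun _ _ => true, fun v : void => match v with end)).
  by split => // A [[]].
pose I n := projT1 (d n).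
pose le n : rel (I n) := (projT2 (d n)).1.
pose s n : I n -> form L := (projT2 (d n)).2.
have wo n : well_order (@le n).
  by have := dP n; rewrite /good /le /I; case: (d n) => ? [? ?] [].
have js n i : justified Theta Sigma (@s n @` [set j | le n j i && (j != i)]) (s n i).
  by move: i; have := dP n; rewrite /good /s /le /I; case: (d n) => ? [? ?] [].
have ex n : provable Theta Sigma (enum n) -> exists i, s n i = enum n.
  by have := dP n; rewrite /good /s /I; case: (d n) => ? [? ?] [].
exists (option {n : nat & I n}), (sum_le le).
exists (fun x => if x is Some u then s (tag u) (tagged u) else a).
split; first exact: sum_le_wo.
  by exists None => // -[].
move=> [[n i]|]; last first.
  (* Every provable formula occurs in some block, and all blocks precede the last point, so the
     premises of the new step are available there. *)
  apply: justified_mono ja => b; have [n <-] := enumP b.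
  by move/ex => [i <-]; exists (Some (Tagged I i)).
apply: justified_mono (js n i) => b [j /andP[ji nij] <-].
exists (Some (Tagged I j)) => //=.
rewrite -/(sum_le le (Some (Tagged I j)) (Some (Tagged I i))) sum_le_same ji /=.
apply: contra nij; rewrite -[_ == _]/(Tagged I j == Tagged I i).
by rewrite -tag_eqE /tag_eq eqxx tagged_asE.
Qed.

End Closure.

(** * Derived rules *)

Ltac prove_tautology :=
  let v := fresh "v" in let vN := fresh "vN" in let vA := fresh "vA" in
  move=> v vN vA; rewrite /Imp /Iff !(vN, vA);
  repeat match goal with |- context [v ?x] => case: (v x) end; by [].

Section DerivedRules.
Variables (L : vocabulary) (Theta : nat -> set (fform L)) (Sigma : set (form L)).
Implicit Types (a b c : form L) (t : fform L).

Local Notation pr := (provable Theta Sigma).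

Lemma pr_axiom a : is_axiom Theta a -> pr a.
Proof. by move=> h; apply: provable_justified; apply: by_axiom. Qed.

Lemma pr_mp a b : pr (Imp a b) -> pr a -> pr b.
Proof. by move=> h1 h2; apply: provable_justified; apply: (R1 _ _ h1). Qed.

Lemma pr_All1 a : pr a -> pr (All1 a).
Proof. by move=> h; apply: provable_justified; apply: R2_first. Qed.

Lemma pr_All2 l a : pr a -> pr (All2 l a).
Proof. by move=> h; apply: provable_justified; apply: R2_second. Qed.

Lemma pr_R3 l c a :
  (forall t, Theta l t -> pr (Imp c (instance l t a))) -> pr (Imp c (All2 l a)).
Proof. by move=> h; apply: provable_justified; apply: R3. Qed.

Lemma pr_taut a : tautology a -> pr a.
Proof. by move=> h; apply: pr_axiom; apply: ax_taut. Qed.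

Lemma pr_taut1 a b : tautology (Imp a b) -> pr a -> pr b.
Proof. by move/pr_taut; apply: pr_mp. Qed.

Lemma pr_taut2 a b c : tautology (Imp a (Imp b c)) -> pr a -> pr b -> pr c.
Proof. by move=> h /(pr_taut1 h); apply: pr_mp. Qed.

Lemma pr_trans a b c : pr (Imp a b) -> pr (Imp b c) -> pr (Imp a c).
Proof. by move=> h1 h2; apply: (pr_taut2 _ h1 h2); prove_tautology. Qed.

Lemma pr_All1s k a : pr a -> pr (All1s k a).
Proof. by move=> h; elim: k => //= k; apply: pr_All1. Qed.

Lemma pr_iter_All2 l k a : pr a -> pr (iter k (All2 l) a).
Proof. by move=> h; elim: k => //= k; apply: pr_All2. Qed.

Lemma pr_All1s_inst k a f :
  pr (All1s k a) -> pr (ren1 (fun i => if i < k then f i else i - k) a).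
Proof.
elim: k a => [|k IH] a h.
  by rewrite (_ : (fun _ => _) = id) ?ren1_id //; apply/funext => i; rewrite subn0.
(* The outermost of the [k.+1] quantifiers binds index [k] of the matrix. *)
have := pr_mp (pr_axiom (ax_inst Theta (All1s k a) (f k))) h.
rewrite ren1_All1s => /IH; rewrite ren1_ren1; congr (provable _ _ (ren1 _ _)).
apply/funext => i /=; rewrite iter_up; case: (ltngtP i k) => [h1|h1|->].
- by rewrite h1 ltnS ltnW.
- rewrite -(subnKC h1); move: (i - k.+1) => j; rewrite addSnnS addKn /=.
  by rewrite addnS -addSn ltnS addSn ltnNge leq_addr /= subSS !addKn.
- by rewrite subnn ltnSn /= ltnNge leq_addr /= addKn.
Qed.

Lemma pr_iter_All2_inst l k a f :
  pr (iter k (All2 l) a) ->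
  pr (ren2 l (fun i => if i < k then f i else i - k) a).
Proof.
elim: k a => [|k IH] a h.
  by rewrite (_ : (fun _ => _) = id) ?ren2_id //; apply/funext => i; rewrite subn0.
have := pr_mp (pr_axiom (A4 Theta l (iter k (All2 l) a) (f k))) h.
rewrite ren2_iter_All2 => /IH; rewrite ren2_ren2.
congr (provable _ _ (ren2 _ _ _)).
apply/funext => i /=; rewrite iter_up; case: (ltngtP i k) => [h1|h1|->].
- by rewrite h1 ltnS ltnW.
- rewrite -(subnKC h1); move: (i - k.+1) => j; rewrite addSnnS addKn /=.
  by rewrite addnS -addSn ltnS addSn ltnNge leq_addr /= subSS !addKn.
- by rewrite subnn ltnSn /= ltnNge leq_addr /= addKn.
Qed.

(* No induction on deductions: generalize the finitely many free variables, *)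
(* then instantiate them. *)
Lemma pr_ren1 f a : pr a -> pr (ren1 f a).
Proof.
have [N hN] := free1_bounded a; move/(pr_All1s N)/(pr_All1s_inst f).
by congr (provable _ _ _); apply: ren1_ext => k /hN ->.
Qed.

Lemma pr_ren2 l f a : pr a -> pr (ren2 l f a).
Proof.
have [N hN] := free2_bounded l a; move/(pr_iter_All2 l N)/(pr_iter_All2_inst f).
by congr (provable _ _ _); apply: ren2_ext => k /hN ->.
Qed.

Lemma pr_All1_elim a : pr (All1 a) -> pr a.
Proof.
(* Instantiation lowers the free indices; the preliminary shift by [S] compensates for this. *)
move=> /(pr_ren1 S) h; have := pr_mp (pr_axiom (ax_inst Theta _ 0)) h.
rewrite -/(ren1 (up S) a) ren1_ren1 (_ : _ \o _ = id) ?ren1_id //.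
by apply/funext => -[].
Qed.

Lemma pr_All1s_elim k a : pr (All1s k a) -> pr a.
Proof. by elim: k => //= k IH /pr_All1_elim. Qed.

Lemma pr_All1_intro a b :
  pr (Imp (ren1 S a) b) -> pr (Imp a (All1 b)).
Proof. by move/pr_All1; apply: pr_mp; apply: pr_axiom; apply: ax_distr. Qed.

Lemma pr_All2_intro l a b :
  pr (Imp (ren2 l S a) b) -> pr (Imp a (All2 l b)).
Proof. by move/(pr_All2 l); apply: pr_mp; apply: pr_axiom; apply: A5. Qed.

(* It suffices to choose n such that x_n occurs neither in c nor in a. *)
Lemma pr_All1_fresh c a :
  (forall n, pr (Imp c (ren1 (scons n id) a))) -> pr (Imp c (All1 a)).
Proof.
have [N hN] := free1_bounded c; have [M hM] := free1_bounded a.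
move/(_ (N + M)) => h; apply: pr_All1_intro.
(* The fresh variable becomes the one to be bound, and the others are shifted to make room. *)
have := pr_ren1 (fun i => if i == N + M then 0 else i.+1) h.
rewrite {1}/ren1 /= -!/(ren1 _ _) ren1_ren1.
congr (provable _ _ (Imp _ _)).
  apply: ren1_ext => k /hN; case: eqP => // ->.
  by rewrite ltnNge leq_addr.
rewrite -[RHS]ren1_id; apply: ren1_ext => -[|k] /hM /=; first by rewrite eqxx.
case: eqP => // -> /ltnW; by rewrite ltnNge leq_addl.
Qed.

Lemma pr_All2_fresh l c a :
  (forall n, pr (Imp c (ren2 l (scons n id) a))) -> pr (Imp c (All2 l a)).
Proof.
have [N hN] := free2_bounded l c; have [M hM] := free2_bounded l a.
move/(_ (N + M)) => h; apply: pr_All2_intro.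
have := pr_ren2 l (fun i => if i == N + M then 0 else i.+1) h.
rewrite {1}/ren2 /= -!/(ren2 _ _ _) ren2_ren2.
congr (provable _ _ (Imp _ _)).
  apply: ren2_ext => k /hN; case: eqP => // ->.
  by rewrite ltnNge leq_addr.
rewrite -[RHS](ren2_id l); apply: ren2_ext => -[|k] /hM /=.
  by rewrite eqxx.
case: eqP => // -> /ltnW; by rewrite ltnNge leq_addl.
Qed.

End DerivedRules.

(** * Second-order variables name definable relations *)

Section NamesDefinable.
Variables (L : vocabulary) (Theta : nat -> set (fform L)) (Sigma : set (form L)).
Implicit Types (a b c : form L) (t : fform L).

Local Notation pr := (provable Theta Sigma).

(** The parameters [y] are free variables, not quantified ones, so asserting this formula also fixes
    which parameters define V_n. *)
Definition names (l n : nat) t (y : nat -> nat) : form L :=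
  All1s l.+1 (Iff (App L n (vars l.+1)) (embed (fren (iter l.+1 up y) t))).

Lemma map_iter_up_vars k f : [tuple of map (iter k up f) (vars k)] = vars k.
Proof.
rewrite -[RHS]map_tuple_id; apply: map_tuple_ext => i.
by rewrite mem_iota iter_up => /andP[_ ->].
Qed.

Lemma ren1_names f l n t y : ren1 f (names l n t y) = names l n t (f \o y).
Proof.
rewrite /names ren1_All1s; congr All1s.
rewrite iter_up_comp -fren_fren -(@ren_embed _ (iter _ up f) (fun=> id)).
by rewrite -{2}(map_iter_up_vars l.+1 f).
Qed.

Lemma ren2_names l f n t y : ren2 l f (names l n t y) = names l (f n) t y.
Proof.
rewrite /names ren2_All1s; congr All1s.
by rewrite /ren2 [LHS]/= !ren_embed !fren_id !map_tuple_id /at_arity eqxx.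
Qed.

Lemma ren1_fapp f k t (ts : k.-tuple nat) y :
  ren1 f (fapp t ts y) = fapp t [tuple of map f ts] (f \o y).
Proof. by rewrite /fapp /ren1 ren_embed fren_fren cat_env_map. Qed.

Lemma ren1_psub_app f l t m y l' k (ts : l'.+1.-tuple nat) :
  ren1 f (psub_app l t m y k ts) = psub_app l t m (f \o y) k [tuple of map f ts].
Proof.
rewrite /psub_app; case: ifP => // _; case: ifP => // _.
exact: ren1_fapp.
Qed.

Lemma ren1_psub f l t m y a :
  ren1 f (psub l t m y a) = psub l t m (f \o y) (ren1 f a).
Proof.
rewrite /ren1; elim: a f m y => //= [l' k ts|l' j k|b IH|b IH c IH'|b IH|l' b IH]
  f m y.
- exact: ren1_psub_app.
- case: ifP => // _; case: ifP => // _.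
  rewrite [LHS](ren_All1s _ _ l'.+1) -/(ren1 _ _); congr All1s.
  rewrite /Iff /Imp /ren1 [LHS]/= -!/(ren1 _ _) !ren1_psub_app.
  rewrite (map_iter_up_vars l'.+1 f).
  suff -> : up (iter l' up f) \o (addn l'.+1 \o y) = addn l'.+1 \o (f \o y) by [].
  apply/funext => i; rewrite /comp -[up _]/(iter l'.+1 up f) iter_up.
  by rewrite ltnNge leq_addr addKn.
- by rewrite IH.
- by rewrite IH IH'.
- by rewrite IH.
- by rewrite up2_id IH.
Qed.

Lemma psub_app_ext l t m y y' l' k (ts : l'.+1.-tuple nat) :
  (forall j, j < nparams l t -> y j = y' j) ->
  psub_app l t m y k ts = psub_app l t m y' k ts.
Proof.
move=> h; rewrite /psub_app; case: eqP => // ell; case: ifP => // _.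
move: ts; rewrite ell => ts.
congr embed; apply: fren_ext => i hi; rewrite /cat_env size_tuple.
case: (ltnP i l.+1) => hl; last by rewrite h // ltn_sub2r // (leq_ltn_trans hl).
by apply: set_nth_default; rewrite size_tuple.
Qed.

Lemma psub_ext l t m y y' a :
  (forall j, j < nparams l t -> y j = y' j) ->
  psub l t m y a = psub l t m y' a.
Proof.
elim: a m y y' => //= [l' k ts|l' j k|b IH|b IH c IH'|b IH|l' b IH] m y y' h.
- exact: psub_app_ext.
- have h' i : i < nparams l t -> (addn l'.+1 \o y) i = (addn l'.+1 \o y') i.
    by move=> /h /= ->.
  by rewrite !(psub_app_ext _ _ _ h').
- by rewrite (IH _ _ _ h).
- by rewrite (IH _ _ _ h) (IH' _ _ _ h).
- by rewrite (IH m (S \o y) (S \o y')) // => i /h /= ->.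
- by rewrite (IH _ _ _ h).
Qed.

Lemma psub_embed l t m y s : psub l t m y (embed s) = embed s.
Proof. by elim: s y => //= [s IH|s IH s' IH'|s IH] y; rewrite IH ?IH'. Qed.

Lemma psub_All1s l t m y k a :
  psub l t m y (All1s k a) = All1s k (psub l t m (addn k \o y) a).
Proof.
elim: k y => [|k IH] y //=; rewrite IH; congr (All1 (All1s _ (psub _ _ _ _ _))).
by apply/funext => i /=; rewrite addnS.
Qed.

(** Once theta replaces V, the claim that V is theta becomes theta <-> theta. *)
Lemma psub_names l t :
  let z := embed (fren (iter l.+1 up id) t) in
  psub l t 0 id (names l 0 t id) = All1s l.+1 (Iff z z).
Proof.
rewrite /names psub_All1s /= !psub_embed /psub_app !eqxx /= /fapp.
by rewrite (cat_env_vars l.+1 id).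
Qed.

(* Write V for V_n. As V may occur in c, discharge the assumption that V is *)
(* theta(.,y) by substituting theta for V through A6; then forall V ~c *)
(* follows by R3. *)
Lemma pr_Neg_unnamed l n c :
  (forall t y, Theta l t -> pr (Imp c (Neg (names l n t y)))) -> pr (Neg c).
Proof.
(* [g] moves V_n to index 0, so that [a] is [c] with V_n made ready for binding. *)
move=> h; pose g i := if i == n then 0 else i.+1.
pose a := ren2 l g c.
have ca : ren2 l (scons n id) a = c.
  rewrite /a ren2_ren2 -[RHS](ren2_id l); apply: ren2_ext => k _ /=.
  by rewrite /g; case: eqP.
suff /(pr_mp (pr_axiom Sigma (A4 Theta l (Neg a) n))) : pr (All2 l (Neg a)).
  by rewrite -ca.
(* R3 only yields implications; a provable identity serves as the antecedent. *)
apply: (pr_mp (a := Eq1 L 0 0)); last by apply: pr_axiom; exact: ax_refl.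
apply: pr_R3 => t ht; set p := nparams l t.
suff hi : pr (instance l t (Neg a)) by apply: (pr_taut1 _ hi); prove_tautology.
apply: pr_All1s; rewrite -/p.
have [N hN] := free1_bounded a.
(* The parameters are taken to be x_N, x_{N+1}, ..., beyond the free variables of [a]. *)
have := pr_ren2 l g (h t (addn N) ht).
rewrite -[ren2 _ _ _]/(Imp a (Neg (ren2 l g (names l n t (addn N))))).
rewrite ren2_names {1}/g eqxx => /(pr_All2 l).
move/(pr_mp (pr_axiom Sigma (A6 _ ht)))/pr_All1s_elim.
(* [f] identifies the parameters x_{p+N+j} of the naming formula with the parameters x_j of the
   substituted theta, and fixes the latter and the free variables of the shifted [a]. *)
pose f i := if i < p + N then i else i - (p + N).
move/(pr_ren1 f); rewrite ren1_psub ren1_ren1 -/p.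
rewrite (@psub_ext l t 0 (f \o id) id); last first.
  by move=> j hj; rewrite /= /f (leq_trans hj) // leq_addr.
set q := f \o addn p.
rewrite -[psub _ _ _ _ _]/(Imp (psub l t 0 id (ren1 q a))
  (Neg (psub l t 0 id (ren1 q (names l 0 t (addn N)))))).
rewrite ren1_names (_ : q \o addn N = id); last first.
  by apply/funext => i; rewrite /q /= /f addnA ltnNge leq_addr addKn.
rewrite (@ren1_ext _ a q (addn p)); last first.
  by move=> k /hN hk; rewrite /q /= /f ltn_add2l hk.
rewrite psub_names => h1.
set z := All1s _ _ in h1.
have hz : pr z by apply/pr_All1s/pr_taut; prove_tautology.
by apply: (pr_taut2 _ h1 hz); prove_tautology.
Qed.

End NamesDefinable.

(** * Henkin sets *)

Section HenkinSets.
Variables (L : vocabulary) (Theta : nat -> set (fform L)) (Sigma : set (form L)).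
Implicit Types (a b c d : form L) (t : fform L) (U : set (form L)).

Local Notation pr := (provable Theta Sigma).

(** A complete theory in which the variables of both sorts play the role of Henkin constants. *)
Record henkin U : Prop := Henkin {
  henkin_pr : forall a, pr a -> U a;
  henkin_mp : forall a b, U (Imp a b) -> U a -> U b;
  henkin_Neg : forall a, U (Neg a) <-> ~ U a;
  henkin_All1 : forall a, (forall n, U (ren1 (scons n id) a)) -> U (All1 a);
  henkin_All2 : forall l a,
    (forall n, U (ren2 l (scons n id) a)) -> U (All2 l a);
  henkin_names : forall l n,
    exists2 t, Theta l t & exists y, U (names l n t y) }.

Definition consistent c := ~ pr (Neg c).

(** Density in the order of provable implication: [And c d] is the consistent strengthening of [c]
    that lies below [d]. *)
Definition dense (D : set (form L)) :=
  forall c, consistent c -> exists2 d, D d & consistent (And c d).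

Lemma inconsistent_And c d : ~ consistent (And c d) -> pr (Imp c (Neg d)).
Proof. by move/contrapT => h; apply: (pr_taut1 _ h); prove_tautology. Qed.

Lemma inconsistent_And_Neg c d : ~ consistent (And c (Neg d)) -> pr (Imp c d).
Proof. by move/contrapT => h; apply: (pr_taut1 _ h); prove_tautology. Qed.

Definition decides a : set (form L) := [set d | d = a \/ d = Neg a].

Lemma dense_decides a : dense (decides a).
Proof.
move=> c hc; have [h|/inconsistent_And h1] := pselect (consistent (And c a)).
  by exists a => //; left.
exists (Neg a); [by right|move=> h2; apply: hc].
by apply: (pr_taut2 _ h1 h2); prove_tautology.
Qed.

(* In the universal cases the negated instance implies Neg a, and also *)
(* provides a witness against a. *)
Definition decides_witnessed a : set (form L) :=
  match a with
  | All1 b => [set d | d = a \/ exists n, d = Neg (ren1 (scons n id) b)]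
  | All2 l b => [set d | d = a \/ exists n, d = Neg (ren2 l (scons n id) b)]
  | _ => decides a
  end.

(** If [c] is incompatible with every negated instance, it implies all instances, among them one at
    a fresh variable, hence the universal formula; so it cannot also be incompatible with that
    formula. *)
Lemma dense_decides_witnessed a : dense (decides_witnessed a).
Proof.
have aux (D : set (form L)) (inst : nat -> form L) :
    (forall n, D (Neg (inst n))) -> D a ->
    (forall c, (forall n, pr (Imp c (inst n))) -> pr (Imp c a)) -> dense D.
  move=> Dinst Da fresh c hc.
  have [h|/inconsistent_And h1] := pselect (consistent (And c a)).
    by exists a.
  apply: contrapT => none; apply: hc.
  have h2 : pr (Imp c a).
    apply: fresh => n; apply: inconsistent_And_Neg => h.
    by apply: none; exists (Neg (inst n)).
  by apply: (pr_taut2 _ h1 h2); prove_tautology.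
case: a aux => [p ts|i j|l m ts|l m n|b|b b'|b|l b] aux;
  try exact: dense_decides.
- apply: (aux _ (fun n => ren1 (scons n id) b)) => [n||c]; last exact: pr_All1_fresh.
    by right; exists n.
  by left.
- apply: (aux _ (fun n => ren2 l (scons n id) b)) => [n||c]; last exact: pr_All2_fresh.
    by right; exists n.
  by left.
Qed.

Definition named l n : set (form L) :=
  [set d | exists2 t, Theta l t & exists y, d = names l n t y].

Lemma dense_named l n : dense (named l n).
Proof.
move=> c hc; apply: contrapT => none; apply: hc.
apply: (@pr_Neg_unnamed _ _ _ l n) => t y ht; apply: inconsistent_And => h.
by apply: none; exists (names l n t y) => //; exists t => //; exists y.
Qed.

(** The Rasiowa-Sikorski lemma: a descending chain of consistent formulas enters the [D k] one by
    one, and [U] is its upward closure. *)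
Lemma generic_filter (D : nat -> set (form L)) c :
  (forall k, dense (D k)) -> consistent c ->
  exists U, [/\ U c, forall a b, pr (Imp a b) -> U a -> U b,
    forall a b, U a -> U b -> U (And a b), forall a, U a -> consistent a
    & forall k, exists2 d, D k d & U d].
Proof.
move=> Ddense hc.
have [next nextP] : {next : nat * form L -> form L & forall kc,
    consistent kc.2 -> D kc.1 (next kc) /\ consistent (And kc.2 (next kc))}.
  apply: (@choice _ _ (fun kc d => consistent kc.2 ->
    D kc.1 d /\ consistent (And kc.2 d))) => -[k b] /=.
  have [/(Ddense k)[d Dd hd]|] := pselect (consistent b); first by exists d.
  (* The value at an inconsistent [b] is irrelevant: the chain stays consistent. *)
  by exists b.
pose fix s k := if k is j.+1 then And (s j) (next (j, s j)) else c.
have hs k : consistent (s k).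
  by elim: k => //= k IH; have [] := nextP (k, s k) IH.
have s_mono j k : j <= k -> pr (Imp (s k) (s j)).
  move/subnKC => <-; elim: (k - j) => [|i IH].
    by rewrite addn0; apply: pr_taut; prove_tautology.
  rewrite addnS; apply: pr_trans IH; apply: pr_taut => /=; prove_tautology.
exists [set a | exists k, pr (Imp (s k) a)]; split.
- by exists 0; apply: pr_taut; prove_tautology.
- by move=> a b hab [k hk]; exists k; apply: pr_trans hab.
- move=> a b [j hj] [k hk]; exists (j + k).
  have h1 := pr_trans (s_mono _ _ (leq_addr k j)) hj.
  have h2 := pr_trans (s_mono _ _ (leq_addl j k)) hk.
  by apply: (pr_taut2 _ h1 h2); prove_tautology.
- move=> a [k hk] ha; apply: (hs k).
  by apply: (pr_taut2 _ hk ha); prove_tautology.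
- move=> k; have [Dd _] := nextP (k, s k) (hs k).
  exists (next (k, s k)) => //; exists k.+1 => /=.
  by apply: pr_taut; prove_tautology.
Qed.

Lemma henkin_exists c : consistent c -> exists2 U, henkin U & U c.
Proof.
move=> hc; have [enum enumP] := form_enumeration L.
pose D k := match unpickle k with
  | Some (inl i) => decides_witnessed (enum i)
  | Some (inr (l, n)) => named l n
  | None => decides c
  end.
have Ddense k : dense (D k).
  rewrite /D; case: (unpickle k) => [[i|[l n]]|].
  - exact: dense_decides_witnessed.
  - exact: dense_named.
  - exact: dense_decides.
have [U [Uc Uimp Uand Ucons UD]] := generic_filter Ddense hc.
exists U => //.
have Udec a : exists2 d, decides_witnessed a d & U d.
  have [i <-] := enumP a.
  by have := UD (pickle (inl i : nat + nat * nat)%type); rewrite /D pickleK.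
have Upr a : pr a -> U a.
  by move=> h; apply: Uimp Uc; apply: (pr_taut1 _ h); prove_tautology.
have Ump a b : U (Imp a b) -> U a -> U b.
  move=> h1 h2; apply: Uimp (Uand _ _ h1 h2).
  by apply: pr_taut; prove_tautology.
have Uabsurd a : U (Neg a) -> U a -> False.
  move=> h1 h2; apply: (Ucons _ (Uand _ _ h1 h2)).
  by apply: pr_taut; prove_tautology.
have UAll1 b : (forall n, U (ren1 (scons n id) b)) -> U (All1 b).
  by have [d [-> //|[n ->]] /Uabsurd h1 h2] := Udec (All1 b); case: h1.
have UAll2 l b : (forall n, U (ren2 l (scons n id) b)) -> U (All2 l b).
  by have [d [-> //|[n ->]] /Uabsurd h1 h2] := Udec (All2 l b); case: h1.
split=> // [a|l n].
- split=> [/Uabsurd //|na].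
  (* Deciding [a] may have put only a negated instance into [U]; by instantiation it implies
     [Neg a]. *)
  have contra b : pr (Imp a b) -> U (Neg b) -> U (Neg a).
    by move=> h; apply: Uimp; apply: (pr_taut1 _ h); prove_tautology.
  have [d hd Ud] := Udec a; case: a na contra hd => [p ts|i j|l m ts|l m n|b|b b'|b|l b] /=
    na contra; case=> [e|]; try (by move: Ud; rewrite e); try by move=> <-.
  + case=> n e; apply: (contra (ren1 (scons n id) b)); last by rewrite -e.
    by apply: pr_axiom; apply: ax_inst.
  + case=> n e; apply: (contra (ren2 l (scons n id) b)); last by rewrite -e.
    by apply: pr_axiom; apply: A4.
- have := UD (pickle (inr (l, n) : nat + nat * nat)%type); rewrite /D pickleK.
  by case=> d [t ht [y ->]] Ud; exists t => //; exists y.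
Qed.

End HenkinSets.

(** * The term model of a Henkin set *)

Lemma cat_env_cons T (x : T) s e : cat_env (x :: s) e = scons x (cat_env s e).
Proof. by apply/funext => -[|i]. Qed.

Lemma map_cat_env_vars T k (ts : k.-tuple T) (e : nat -> T) :
  [tuple of map (cat_env ts e) (vars k)] = ts.
Proof.
apply: (@eq_from_tnth _ _ _ _) => i; rewrite tnth_map /tnth /= nth_iota //.
rewrite add0n /cat_env; apply: set_nth_default; by rewrite size_tuple.
Qed.

Lemma cat_env_iter_up k (ts : k.-tuple nat) y :
  cat_env ts id \o iter k up y = cat_env ts y.
Proof.
apply/funext => i /=; rewrite iter_up /cat_env size_tuple.
case: ltnP => h; first by apply: set_nth_default; rewrite size_tuple.
by rewrite addKn !nth_default // size_tuple // leq_addr.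
Qed.

Section TermModel.
Variables (L : vocabulary) (Theta : nat -> set (fform L)) (Sigma : set (form L)).
Variables (U : set (form L)) (hU : henkin Theta Sigma U).
Implicit Types (a b c d : form L) (t : fform L).

Local Notation pr := (provable Theta Sigma).
Local Notation Upr := (henkin_pr hU).
Local Notation Ump := (henkin_mp hU).

(** * Connectives, quantifiers and identity in a Henkin set *)

Lemma U_axiom a : is_axiom Theta a -> U a.
Proof. by move=> h; apply: Upr; apply: pr_axiom. Qed.

Lemma U_taut1 a b : tautology (Imp a b) -> U a -> U b.
Proof. by move=> h; apply: Ump; apply: Upr; apply: pr_taut. Qed.

Lemma U_taut2 a b c : tautology (Imp a (Imp b c)) -> U a -> U b -> U c.
Proof. by move=> h /(U_taut1 h); apply: Ump. Qed.

Lemma U_Neg a : U (Neg a) <-> ~ U a. Proof. exact: henkin_Neg hU a. Qed.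

Lemma U_And a b : U (And a b) <-> U a /\ U b.
Proof.
split=> [h|[h1 h2]]; last by apply: (U_taut2 _ h1 h2); prove_tautology.
by split; apply: (U_taut1 _ h); prove_tautology.
Qed.

Lemma U_Imp a b : U (Imp a b) <-> (U a -> U b).
Proof.
split=> [|h]; first exact: Ump.
apply/U_Neg => /U_And[/h h1 /U_Neg]; exact.
Qed.

Lemma U_Iff a b : U (Iff a b) <-> (U a <-> U b).
Proof.
split=> [/U_And[/U_Imp h1 /U_Imp h2] //|[h1 h2]].
by apply/U_And; split; apply/U_Imp.
Qed.

Lemma U_All1 a : U (All1 a) <-> forall n, U (ren1 (scons n id) a).
Proof.
split=> [h n|]; last exact: (henkin_All1 hU).
by apply: Ump h; apply: U_axiom; apply: ax_inst.
Qed.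

Lemma U_All2 l a : U (All2 l a) <-> forall n, U (ren2 l (scons n id) a).
Proof.
split=> [h n|]; last exact: (henkin_All2 hU).
by apply: Ump h; apply: U_axiom; apply: A4.
Qed.

Lemma U_Ex2 l a : U (Ex2 l a) -> exists n, U (ren2 l (scons n id) a).
Proof.
move=> /U_Neg h; apply: contrapT => none; apply: h; apply/U_All2 => n.
by apply/U_Neg => h; apply: none; exists n.
Qed.

Lemma U_All1s k a :
  U (All1s k a) <-> forall ts : k.-tuple nat, U (ren1 (cat_env ts id) a).
Proof.
elim: k a => [|k IH] a.
  have e0 (ts : 0.-tuple nat) : cat_env ts id = id.
    by rewrite tuple0; apply/funext => i; rewrite /cat_env /= subn0 nth_nil.
  by split=> [h ts|/(_ [tuple])]; rewrite e0 ren1_id.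
have step n (ts : seq nat) b : ren1 (scons n id) (ren1 (up (cat_env ts id)) b) =
    ren1 (cat_env (n :: ts) id) b.
  rewrite ren1_ren1 cat_env_cons; congr ren1.
  by apply/funext => -[|i].
rewrite /All1s iterSr -/(All1s _ _); split=> [/IH h ts|h].
  case/tupleP: ts => n ts /=; rewrite -step.
  by have /U_All1 := h ts; apply.
apply/IH => ts; apply/U_All1 => n; rewrite -/(ren1 _ _) step.
exact: (h [tuple of n :: ts]).
Qed.

Lemma U_eq_subst i j b :
  U (Eq1 L i j) -> U (ren1 (scons i id) b) -> U (ren1 (scons j id) b).
Proof. by move=> h; apply: Ump; apply: Ump h; apply: U_axiom; apply: ax_eq. Qed.

Lemma U_eq_refl i : U (Eq1 L i i).
Proof. by apply: U_axiom; apply: ax_refl. Qed.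

Lemma U_eq_sym i j : U (Eq1 L i j) -> U (Eq1 L j i).
(* Index 0 marks the replaced occurrence, so [i.+1] denotes the variable [i]. *)
Proof. by move=> h; apply: (U_eq_subst (b := Eq1 L 0 i.+1) h); apply: U_eq_refl. Qed.

Lemma U_eq_trans i j k : U (Eq1 L i j) -> U (Eq1 L j k) -> U (Eq1 L i k).
Proof. by move/U_eq_sym => h; apply: (U_eq_subst (b := Eq1 L 0 k.+1) h). Qed.

(** [ax_eq] replaces one variable at a time, and finitely many replacements suffice for the free
    variables of [a]. *)
Lemma U_eq_ren1 f f' a :
  (forall i, U (Eq1 L (f i) (f' i))) -> U (ren1 f a) -> U (ren1 f' a).
Proof.
move=> hf h; have [N hN] := free1_bounded a.
rewrite -(@ren1_ext _ a (fun i => if i < N then f' i else f i)); last first.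
  by move=> k /hN ->.
elim: N {hN} => //= k IH.
pose g i := if i == k then 0 else (if i < k then f' i else f i).+1.
have := @U_eq_subst (f k) (f' k) (ren1 g a) (hf k); rewrite !ren1_ren1.
rewrite (_ : _ \o g = fun i => if i < k then f' i else f i); last first.
  by apply/funext => i; rewrite /g /=; case: eqP => // ->; rewrite ltnn.
rewrite (_ : _ \o g = fun i => if i < k.+1 then f' i else f i).
  by apply; exact: IH.
apply/funext => i; rewrite /g /= [in RHS]ltnS [in RHS]leq_eqVlt.
by case: (i =P k) => [->|_].
Qed.

(** The least index of each identity class represents it, which makes the quotient a subtype of
    [nat]. *)
Definition rep i : nat := ex_minn
  (P := fun j => `[< U (Eq1 L i j) >])
  (ex_intro _ i (introT (asboolP _) (U_eq_refl i))).

Lemma U_eq_rep i : U (Eq1 L i (rep i)).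
Proof. by rewrite /rep; case: ex_minnP => j /asboolP. Qed.

Lemma rep_eq i j : rep i = rep j <-> U (Eq1 L i j).
Proof.
split=> [e|h].
  by apply: U_eq_trans (U_eq_rep i) _; rewrite e; apply/U_eq_sym/U_eq_rep.
apply: eq_ex_minn => k; apply/asboolP/asboolP; apply: U_eq_trans => //.
exact: U_eq_sym.
Qed.

Lemma rep_rep i : rep (rep i) == rep i.
Proof. by apply/eqP/rep_eq/U_eq_sym/U_eq_rep. Qed.

Definition point := {i : nat | rep i == i}.

Definition pt (i : nat) : point := exist _ (rep i) (rep_rep i).

Definition term_model : structure L :=
  @Structure L point (inhabits (pt 0))
    (fun p => [set d : (parity p).-tuple point | U (Pred [tuple of map val d])]).

Local Notation M := term_model.

Definition named_rel : valuation2 M :=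
  fun l n => [set d : l.+1.-tuple point | U (App L n [tuple of map val d])].

Lemma pt_val (x : point) : pt (val x) = x.
Proof. by apply/val_inj/eqP; exact: (valP x). Qed.

Lemma map_pt_val k (d : k.-tuple point) : [tuple of map pt [tuple of map val d]] = d.
Proof.
rewrite map_tuple_comp -[RHS]map_tuple_id; apply: map_tuple_ext => x _.
exact: pt_val.
Qed.

Lemma U_Pred_rep p (ts : (parity p).-tuple nat) :
  U (Pred [tuple of map rep ts]) <-> U (Pred ts).
Proof.
split=> h; last by apply: (@U_eq_ren1 id rep (Pred ts) U_eq_rep); rewrite ren1_id.
rewrite -[Pred ts]ren1_id; apply: (@U_eq_ren1 rep id (Pred ts)) h => i.
exact/U_eq_sym/U_eq_rep.
Qed.

Lemma U_App_rep l n (ts : l.+1.-tuple nat) :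
  U (App L n [tuple of map rep ts]) <-> U (App L n ts).
Proof.
split=> h; last by apply: (@U_eq_ren1 id rep (App L n ts) U_eq_rep); rewrite ren1_id.
rewrite -[App L n ts]ren1_id; apply: (@U_eq_ren1 rep id (App L n ts)) h => i.
exact/U_eq_sym/U_eq_rep.
Qed.

Lemma interp_pt p (ts : (parity p).-tuple nat) f :
  @interp L M p [tuple of map (pt \o f) ts] <-> U (Pred [tuple of map f ts]).
Proof. by rewrite -U_Pred_rep /= !map_tuple_comp. Qed.

Lemma named_rel_pt l n (ts : l.+1.-tuple nat) f :
  named_rel n [tuple of map (pt \o f) ts] <-> U (App L n [tuple of map f ts]).
Proof. by rewrite -U_App_rep /named_rel /= !map_tuple_comp. Qed.

Lemma pt_eq i j : pt i = pt j <-> U (Eq1 L i j).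
Proof.
rewrite -rep_eq; split=> [[]//|e]; exact: val_inj.
Qed.

Lemma scons_pt i f : scons (pt i) (pt \o f) = pt \o scons i f.
Proof. by apply/funext => -[]. Qed.

(** The first-order truth lemma comes separately, because K_Theta, over which the second-order
    quantifiers range, is defined through [fsat]. *)
Lemma fsat_term_model t f :
  fsat (A := M) (pt \o f) t <-> U (embed (fren f t)).
Proof.
elim: t f => [p ts|i j|t IH|t IH t' IH'|t IH] f.
- exact: interp_pt.
- exact: pt_eq.
- by rewrite /= U_Neg IH.
- by rewrite /= U_And IH IH'.
- rewrite /= U_All1; split=> h x.
    have /= := h (pt x); rewrite scons_pt IH /ren1 ren_embed fren_fren.
    by rewrite (_ : _ \o up f = scons x f) //; apply/funext => -[].
  have := h (val x); rewrite /ren1 ren_embed fren_fren.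
  rewrite (_ : _ \o up f = scons (val x) f); last by apply/funext => -[].
  by rewrite -IH -scons_pt pt_val.
Qed.

Lemma U_names l n t y : U (names l n t y) <-> forall ts : l.+1.-tuple nat,
  (U (App L n ts) <-> U (embed (fren (cat_env ts y) t))).
Proof.
rewrite /names U_All1s.
have e (ts : l.+1.-tuple nat) :
    ren1 (cat_env ts id)
      (Iff (App L n (vars l.+1)) (embed (fren (iter l.+1 up y) t))) =
    Iff (App L n ts) (embed (fren (cat_env ts y) t)).
  rewrite -(cat_env_iter_up ts y) -fren_fren -(@ren_embed _ (cat_env ts id) (fun=> id)).
  by rewrite -{2}[ts](map_cat_env_vars ts id).
by split=> h ts; [apply/U_Iff; rewrite -e|rewrite e; apply/U_Iff].
Qed.

Lemma named_relE l n t y : U (names l n t y) ->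
  named_rel n = [set d : l.+1.-tuple point | fsat (A := M) (cat_env d (pt \o y)) t].
Proof.
move/U_names => h.
apply/funext => d; apply/propext; rewrite -[d]map_pt_val.
move: [tuple of map val d] => ts.
rewrite /= cat_env_map fsat_term_model -h -[ts in U (App _ _ ts)]map_tuple_id.
exact: named_rel_pt.
Qed.

Lemma named_rel_definable l n : definable (A := M) Theta (@named_rel l n).
Proof.
have [t ht [y hy]] := henkin_names hU l n.
by exists t => //; exists (pt \o y); apply: named_relE.
Qed.

Lemma env_pt (e : nat -> point) : e = pt \o (val \o e).
Proof. by apply/funext => i; rewrite /= pt_val. Qed.

Lemma definable_named_rel l (B : set (l.+1.-tuple (dom M))) :
  definable Theta B -> exists n, B = named_rel n.
Proof.
case=> t ht [e ->]; rewrite (env_pt e); move: (val \o e) => y.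
suff /U_Ex2[n hn] : U (Ex2 l (names l 0 t y)).
  by exists n; rewrite (@named_relE l n t y) // -[n]/(scons n id 0) -ren2_names.
(* A1 speaks of theta with its own parameters; renaming them by [y] gives the required comprehension
   instance. *)
have -> : Ex2 l (names l 0 t y) = ren1 y (Ex2 l (names l 0 t id)).
  by rewrite -[names l 0 t y](ren1_names y) /ren1 /= up2_id.
apply/Upr/pr_ren1; apply: (@pr_All1s_elim _ _ _ (nparams l t)).
rewrite /names iter_up_id fren_id; exact/pr_axiom/A1.
Qed.

Lemma update2_named_rel l n (g : nat -> nat -> nat) :
  update2 (A := M) (@named_rel l n) (fun l' m => named_rel (g l' m)) =
  fun l' m => named_rel (if l' == l then scons n (g l) m else g l' m).
Proof.
apply: functional_extensionality_dep => l'; rewrite /update2.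
case: dfwithP => [|l'' ne]; apply/funext => m.
  by rewrite eqxx; case: m.
by rewrite eq_sym (negbTE ne).
Qed.

(** By A2 identity amounts to coextensiveness, which [U] decides on tuples of variables, and these
    represent all tuples of points. *)
Lemma U_Eq2 l m n : U (Eq2 L l m n) <-> @named_rel l m = @named_rel l n.
Proof.
have h : U (Iff (All1s l.+1 (Iff (App L m (vars l.+1)) (App L n (vars l.+1))))
    (Eq2 L l m n)).
  have := Upr (pr_iter_All2_inst (k := 2)
    (fun i => if i == 0 then n else m) (pr_axiom Sigma (A2 Theta l))).
  have ren2_Iff f a b : ren2 l f (Iff a b) = Iff (ren2 l f a) (ren2 l f b) by [].
  have ren2_App f k : ren2 l f (App L k (vars l.+1)) = App L (f k) (vars l.+1).
    by rewrite /ren2 /= /at_arity eqxx map_tuple_id.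
  rewrite ren2_Iff ren2_All1s ren2_Iff !ren2_App.
  by rewrite /ren2 /= /at_arity eqxx.
have e (ts : l.+1.-tuple nat) :
    ren1 (cat_env ts id) (Iff (App L m (vars l.+1)) (App L n (vars l.+1))) =
    Iff (App L m ts) (App L n ts).
  by rewrite -{2 3}[ts](map_cat_env_vars ts id).
move/U_Iff: h => <-; rewrite U_All1s; split=> [hmn|hmn ts].
  apply/funext => d; apply/propext; apply/U_Iff; rewrite -e; exact: hmn.
rewrite e; apply/U_Iff; rewrite -[ts]map_tuple_id.
by rewrite -!(named_rel_pt _ _ id) hmn.
Qed.

(** The truth lemma, by induction on [a] for all renamings, as a quantifier extends the assignment.
    For [All2], the relations in K_Theta and the named ones coincide. *)
Lemma sat_term_model a f g :
  sat (A := M) Theta (pt \o f) (fun l m => named_rel (g l m)) a <->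
  U (ren f g a).
Proof.
elim: a f g => [p ts|i j|l m ts|l m n|b IH|b IH c IH'|b IH|l b IH] f g.
- exact: interp_pt.
- exact: pt_eq.
- exact: named_rel_pt.
- by rewrite /= U_Eq2.
- by rewrite /= U_Neg IH.
- by rewrite /= U_And IH IH'.
- rewrite /= U_All1; split=> h x.
    have /= := h (pt x); rewrite scons_pt IH /ren1 ren_ren.
    by rewrite (_ : _ \o up f = scons x f) //; apply/funext => -[].
  have := h (val x); rewrite /ren1 ren_ren.
  rewrite (_ : _ \o up f = scons (val x) f); last by apply/funext => -[].
  by rewrite -IH -scons_pt pt_val.
- have step n : sat (A := M) Theta (pt \o f)
      (update2 (@named_rel l n) (fun l' m => named_rel (g l' m))) b <->
      U (ren2 l (scons n id) (ren f (up2 l g) b)).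
    rewrite update2_named_rel.
    rewrite (IH f (fun l' m => if l' == l then scons n (g l) m else g l' m)).
    rewrite /ren2 ren_ren.
    suff -> : (fun l' m => if l' == l then scons n (g l) m else g l' m) =
      fun l' => at_arity l (scons n id) l' \o up2 l g l' by [].
    apply/funext => l'; apply/funext => m; rewrite /at_arity /up2 /=.
    by case: eqP => // ->; case: m.
  rewrite /= U_All2; split=> h.
    by move=> n; apply/step; apply: h; apply: named_rel_definable.
  by move=> B /definable_named_rel[n ->]; apply/step.
Qed.

(** Every admissible assignment comes from renamings [f] and [g], and these leave a sentence
    unchanged. *)
Lemma term_model_models a : sentence a -> U a -> models M Theta a.
Proof.
move=> sa Ua e V hV; rewrite (env_pt e).
have [g hg] : {g : nat * nat -> nat & forall x, V x.1 x.2 = @named_rel x.1 (g x)}.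
  apply: (@choice _ _ (fun x n => V x.1 x.2 = @named_rel x.1 n)) => x.
  exact: definable_named_rel.
have -> : V = fun l m => named_rel (g (l, m)).
  apply: functional_extensionality_dep => l; apply/funext => m.
  exact: (hg (l, m)).
apply/(sat_term_model _ _ (fun l m => g (l, m))).
by rewrite sentence_ren.
Qed.

End TermModel.

Theorem mainTheorem4 (L : vocabulary) (Theta : nat -> set (fform L))
    (hTheta : forall l, countable (Theta l))
    (Sigma : set (form L)) (phi : form L)
    (hcountable : countable (Sigma `|` [set phi]))
    (hsentences : Sigma `|` [set phi] `<=` @sentence L)
    (hunprovable : ~ provable Theta Sigma phi) :
  exists A : structure L,
    (forall sigma, Sigma sigma -> models A Theta sigma) /\
    ~ models A Theta phi.
Proof.
have phi_consistent : consistent Theta Sigma (Neg phi).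
  by move=> h; apply: hunprovable; apply: (pr_taut1 _ h); prove_tautology.
have [U hU /(henkin_Neg hU) Uphi] := henkin_exists phi_consistent.
exists (term_model hU); split=> [sigma hsigma|phi_true].
  apply: term_model_models; first by apply: hsentences; left.
  by apply: (henkin_pr hU); apply: provable_justified; apply: by_hyp.
(* [phi] fails already when each variable denotes its own class or its own named relation. *)
apply: Uphi; rewrite -[phi]ren_id; apply/(sat_term_model hU phi id (fun=> id)).
apply: phi_true => l m; exact: named_rel_definable.
Qed.
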